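(* For each integer $k\geq 2$, the limit $c_k=\lim_{n\to\infty}\frac{\mathcal{M}_n}{n}$ exists, where $n$ ranges over those positive integers for which a connected $k$-regular graph on $n$ vertices exists, and $\mathcal{M}_n$ is the maximum of $\rho(G)$ over all connected $k$-regular graphs $G$ on $n$ vertices.
   Context: Graphs are finite and simple. An induced path factor (IPF) of a graph $G$ is a set of induced paths in $G$ such that every vertex of $G$ is in exactly one of the paths; paths of any length are allowed, including trivial paths consisting of a single vertex. The induced path number $\rho(G)$ is the minimum number of paths in an IPF of $G$. *)

(* Defs.v *)
From mathcomp Require Import all_boot.

Set Implicit Arguments.
Unset Strict Implicit.
Unset Printing Implicit Defensive.

(* The notions below are stated for an adjacency relation e on a finite
   vertex type T; a graph is simple when e is symmetric and irreflexive. *)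

Definition simple_graph (T : finType) (e : rel T) : bool :=
  [forall x, ~~ e x x] && [forall x, forall y, e x y == e y x].

Definition regular (T : finType) (k : nat) (e : rel T) : bool :=
  [forall x, #|[set y | e x y]| == k].

Definition connected_graph (T : finType) (e : rel T) : bool :=
  (0 < #|T|) && [forall x, forall y, connect e x y].

(* The vertices p_0, ..., p_(m-1) are distinct and, in the whole graph, p_i and
   p_j are adjacent exactly when i and j are consecutive; m = 1 is allowed. *)
Definition induced_path (T : finType) (e : rel T) (m : nat) (p : m.-tuple T) :
    bool :=
  [&& 0 < m, uniq p &
    [forall i, forall j,
      e (tnth p i) (tnth p j) == ((i.+1 == j) || (j.+1 == i))]].

(* An induced path, being an induced subgraph, is determined by its vertex set;
   induced paths are therefore represented by their vertex sets, so that a path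
   and its reversal are the same object. *)
Definition induced_path_set (T : finType) (e : rel T) (S : {set T}) : bool :=
  [exists p : #|S|.-tuple T, (S == [set x in p]) && induced_path e p].

Definition induced_path_factor (T : finType) (e : rel T) (P : {set {set T}}) :
    bool :=
  partition P [set: T] && [forall S in P, induced_path_set e S].

Definition trivial_factor (T : finType) : {set {set T}} :=
  [set [set x] | x : T].

Lemma trivial_factorP (T : finType) (e : rel T) :
  simple_graph e -> induced_path_factor e (trivial_factor T).
Proof.
case/andP=> /forallP irr _; apply/andP; split.
  apply/and3P; split.
  - rewrite eqEsubset subsetT; apply/subsetP=> x _.
    by apply/bigcupP; exists [set x]; rewrite ?in_set1 ?imset_f.
  - apply/trivIsetP=> _ _ /imsetP[x _ ->] /imsetP[y _ ->] nxy.
    by rewrite disjoints1 in_set1; apply: contraNneq nxy => ->.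
  - apply/negP=> /imsetP[x _ /setP/(_ x)].
    by rewrite in_set0 in_set1 eqxx.
apply/forall_inP=> _ /imsetP[x _ ->]; rewrite /induced_path_set cards1.
apply/existsP; exists [tuple x]; apply/andP; split.
  by apply/eqP/setP=> y; rewrite !inE.
by apply/and3P; split=> //; apply/'forall_forallP=> i j;
  rewrite !ord1 (tnth_nth x) /= (negbTE (irr x)).
Qed.

(* The default value of the arg min is a factor by trivial_factorP, so on simple
   graphs this is a genuine minimum. *)
Definition induced_path_number (T : finType) (e : rel T) : nat :=
  #|[arg min_(P < trivial_factor T | induced_path_factor e P) #|P|]%N|.

Lemma induced_path_numberP (T : finType) (e : rel T) : simple_graph e ->
  (exists2 P, induced_path_factor e P & #|P| = induced_path_number e) /\
  (forall P, induced_path_factor e P -> induced_path_number e <= #|P|).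
Proof.
move=> /trivial_factorP triv; rewrite /induced_path_number.
by case: arg_minnP => // P ipfP minP; split; first exists P.
Qed.

(* Up to isomorphism a graph on n vertices has vertex type 'I_n; it is given by
   its set of ordered adjacent pairs, so that graphs range over a finite type. *)
Definition adj (n : nat) (E : {set 'I_n * 'I_n}) : rel 'I_n :=
  [rel x y | (x, y) \in E].

Definition connected_regular (k n : nat) (E : {set 'I_n * 'I_n}) : bool :=
  [&& simple_graph (adj E), regular k (adj E) & connected_graph (adj E)].

Definition admissible_order (k n : nat) : bool :=
  [exists E : {set 'I_n * 'I_n}, connected_regular k E].

(* Equal to 0 when no connected k-regular graph on n vertices exists; only
   admissible n are used. *)
Definition max_induced_path_number (k n : nat) : nat :=
  \max_(E : {set 'I_n * 'I_n} | connected_regular k E)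
    induced_path_number (adj E).

(* Main.v *)
Require Import Defs.
From HB Require Import structures.
From mathcomp Require Import all_boot all_order all_algebra.
From mathcomp Require Import all_classical all_reals all_analysis.
From mathcomp Require Import lra.
Import Order.TTheory GRing.Theory Num.Theory.
Import numFieldNormedType.Exports.

(* Let M_n be the maximum of rho over connected k-regular graphs of order n.
   Given such graphs G and H, choose a non-bridge edge ab of G (one exists as all
   degrees are at least 2) and any edge cd of H; replacing ab and cd by ac and bd
   yields a connected k-regular graph. Cutting an induced path factor of it at a,
   b, c and d creates at most 8 new paths and leaves a factor of G together with
   a factor of H, so M_n + M_m <= M_(n+m) + 8. Fekete's lemma on the semigroup of
   admissible orders then gives the limit. *)

Set Implicit Arguments.
Unset Strict Implicit.
Unset Printing Implicit Defensive.

(** * Induced paths as sequences, and factors as colourings *)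

(** The empty sequence qualifies, so cutting a path at an end needs no special case. *)
Definition ipath (T : eqType) (e : rel T) (p : seq T) : Prop :=
  uniq p /\ forall x0 i j, i < size p -> j < size p ->
    e (nth x0 p i) (nth x0 p j) = (i.+1 == j) || (j.+1 == i).

(* An induced path factor, given as a map to path labels; unused labels, with an
   empty class, are allowed. *)
Definition path_coloring (T : finType) (I : eqType) (e : rel T) (c : T -> I) :
    Prop :=
  forall i, exists2 p, p =i [pred x | c x == i] & ipath e p.

Lemma ipath_cat (T : eqType) (e : rel T) (p q : seq T) :
  ipath e (p ++ q) -> ipath e p /\ ipath e q.
Proof.
case; rewrite cat_uniq size_cat => /and3P[up _ uq] adj_pq; split; split=> //.
  move=> x0 i j lti ltj.
  by have := adj_pq x0 i j; rewrite !nth_cat lti ltj; apply; apply: ltn_addr.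
move=> x0 i j lti ltj; have := adj_pq x0 (size p + i) (size p + j).
rewrite !nth_cat !ltnNge !leq_addr /= !addKn -!ltnNge !ltn_add2l.
by move=> ->//; rewrite -!addnS !eqn_add2l.
Qed.

Lemma ipath_seq1 (T : eqType) (e : rel T) (p : seq T) (x : T) :
  ipath e p -> x \in p -> ipath e [:: x].
Proof.
move=> ip xp; case/splitPr: xp ip => p1 p2 /ipath_cat[_].
by rewrite -cat1s => /ipath_cat[].
Qed.

Lemma induced_path_setP (T : finType) (e : rel T) (S : {set T}) :
  induced_path_set e S <->
  exists2 p, S = [set x in p]%SET & p <> [::] /\ ipath e p.
Proof.
split=> [/existsP[p /andP[/eqP defS /and3P[S0 up /'forall_forallP adj_p]]]|].
  exists (val p) => //; split; first by case: p S0 {defS up adj_p} => -[] //= /eqP <-.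
  split=> // x0 i j; rewrite size_tuple => lti ltj.
  by have := eqP (adj_p (Ordinal lti) (Ordinal ltj)); rewrite !(tnth_nth x0).
case=> p -> [p0 [up adj_p]]; have szp : size p == #|[set x in p]%SET|.
  by rewrite cardsE (card_uniqP up).
apply/existsP; exists (Tuple szp); rewrite eqxx /=; apply/and3P; split=> //.
  by rewrite -(eqP szp) lt0n size_eq0; apply/eqP.
apply/'forall_forallP=> i j; have x0 := tnth (Tuple szp) i.
rewrite !(tnth_nth x0).
by apply/eqP/adj_p; rewrite (eqP szp).
Qed.

(** The nonempty classes form an induced path factor. Counting labels in a set [A], rather than in
    all of [I], lets two graphs share one label type and use disjoint parts of it. *)
Lemma induced_path_number_le (T I : finType) (e : rel T) (c : T -> I)
    (A : {set I}) :
  simple_graph e -> path_coloring e c -> (forall x, c x \in A) ->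
  induced_path_number e <= #|A|.
Proof.
move=> simp_e c_path cA; have [_ min_e] := induced_path_numberP simp_e.
pose cls i := [set x | c x == i]%SET.
suff ipf : induced_path_factor e (cls @: (c @: [set: T]))%SET.
  apply: leq_trans (min_e _ ipf) _; apply: leq_trans (leq_imset_card _ _) _.
  by apply/subset_leq_card/fintype.subsetP=> _ /imsetP[x _ ->].
apply/andP; split; last first.
  apply/forall_inP=> _ /imsetP[_ /imsetP[x _ ->] ->].
  have [p def_p ip] := c_path (c x); apply/induced_path_setP; exists p.
    by apply/setP=> y; rewrite !inE def_p.
  by split=> // p0; have := def_p x; rewrite p0 !inE eqxx.
apply/and3P; split.
- rewrite finset.eqEsubset finset.subsetT; apply/fintype.subsetP=> x _.
  apply/bigcupP; exists (cls (c x)); last by rewrite inE.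
  by apply/imset_f/imset_f; rewrite inE.
- apply/finset.trivIsetP=> _ _ /imsetP[i _ ->] /imsetP[j _ ->] nij.
  rewrite disjoint_subset; apply/fintype.subsetP=> x; rewrite !inE => /eqP cx.
  by apply: contraNneq nij => <-; rewrite cx.
- apply/negP=> /imsetP[_ /imsetP[x _ ->] /setP/(_ x)].
  by rewrite !inE eqxx.
Qed.

Lemma induced_path_number_coloring (T : finType) (e : rel T) :
  simple_graph e ->
  exists (I : finType) (c : T -> I),
    path_coloring e c /\ #|I| = induced_path_number e.
Proof.
move=> /induced_path_numberP[[P /andP[partP /forall_inP pathP] <-] _].
have covP x : x \in finset.cover P by rewrite (cover_partition partP) inE.
exists {S | S \in P}, (fun x => Sub (finset.pblock P x) (finset.pblock_mem (covP x))).
split; last by rewrite card_sig.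
case=> S PS; have /induced_path_setP[p defS [_ ip]] := pathP S PS.
exists p => // x; have [_ trivP _] := and3P partP.
rewrite !inE -val_eqE /= -(@finset.in_set _ [in p]) -defS.
apply/idP/eqP=> [Sx | <-]; first exact: finset.def_pblock.
by rewrite finset.mem_pblock.
Qed.

(* The class of v is cut into v, the part before v and the part after v. *)
Lemma isolate_vertex (T : finType) (I : eqType) (e : rel T) (c : T -> I) (v : T) :
  path_coloring e c ->
  exists c' : T -> option (option I),
    [/\ path_coloring e c', forall x, c' x = c' v -> x = v &
        forall x y, c' x = c' y -> c x = c y].
Proof.
move=> c_path; have [p def_p ip] := c_path (c v).
have vp : v \in p by rewrite def_p inE.
have iv := ipath_seq1 ip vp.
case/splitPr: vp def_p ip => p1 p2 def_p ip.
have [ip1 /(ipath_cat (p := [:: v])) [_ ip2]] := ipath_cat ip.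
have cp2 x : x \in p2 -> c x = c v.
  move=> xp2; have := def_p x.
  by rewrite mem_cat !inE xp2 !orbT => /esym/eqP.
(* The part before [v] keeps the old label, so each isolation costs exactly two new labels. *)
exists (fun x => if x == v then None else
  if x \in p2 then Some None else Some (Some (c x))); split.
- case=> [[i|]|].
  + have [-> | ni] := eqVneq i (c v).
      exists p1 => // x; rewrite inE.
      have := def_p x; rewrite mem_cat !inE; case: ip => [+ _].
      rewrite cat_uniq /= negb_or => /and4P[_ /andP[vp1 /hasPn p12] vp2 _].
      have [-> | _] := eqVneq x v; first by rewrite (negbTE vp1).
      case: ifP => [/p12/negbTE -> // | _].
      by rewrite !orbF => ->.
    have [q def_q iq] := c_path i; exists q => // x; rewrite def_q !inE.
    have [-> | _] := eqVneq x v; first by rewrite eq_sym (negbTE ni).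
    by case: ifP => // /cp2 ->; rewrite eq_sym (negbTE ni).
  + exists p2 => // x; rewrite !inE; case: ip => [+ _].
    rewrite cat_uniq => /and3P[_ _ /=/andP[vp2 _]].
    by have [-> | _] := eqVneq x v; [rewrite (negbTE vp2) | case: ifP].
  + by exists [:: v] => // x; rewrite !inE; case: eqVneq => // _; case: ifP.
- by move=> x; rewrite eqxx; case: eqVneq => // _; case: ifP.
- move=> x y; case: (eqVneq x v) => [->|_]; case: (eqVneq y v) => [->|_];
    by do ?[case: ifP => [/cp2-> | _]] => // -[->].
Qed.

Lemma subset_codom_map (T1 : finType) (T : eqType) (h : T1 -> T) (p : seq T) :
  {subset p <= codom h} -> exists q, p = map h q.
Proof.
elim: p => [|x p IHp] sub_p; first by exists [::].
have [|q ->] := IHp; first by move=> y yp; apply: sub_p; rewrite inE yp orbT.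
have /codomP[x' ->] := sub_p x (mem_head _ _).
by exists (x' :: q).
Qed.

(** A class that meets the image of [h] lies inside it, so its path pulls back whole; adjacency is
    compared only within a class. This restricts a factor of the glued graph to either side. *)
Lemma path_coloring_comp (T1 T : finType) (I : eqType) (e1 : rel T1)
    (e : rel T) (h : T1 -> T) (c : T -> I) :
  injective h -> path_coloring e c ->
  (forall x y, c (h x) = c y -> y \in codom h) ->
  (forall x y, c (h x) = c (h y) -> e1 x y = e (h x) (h y)) ->
  path_coloring e1 (c \o h).
Proof.
move=> h_inj c_path c_cls c_adj i.
have [p def_p [up adj_p]] := c_path i.
have [/existsP[x /eqP cx] | nx] := boolP [exists x, c (h x) == i]; last first.
  exists [::] => // x; rewrite !inE; apply/esym; apply: contraNF nx => cx.
  by apply/existsP; exists x.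
have [|q def_q] := @subset_codom_map _ _ h p.
  by move=> y; rewrite def_p inE => /eqP cy; apply: (c_cls x); rewrite cy.
move: def_p up adj_p; rewrite def_q => def_p up adj_p.
have mem_q y : (y \in q) = (c (h y) == i) by rewrite -(mem_map h_inj) def_p inE.
exists q => [y | ]; first by rewrite mem_q.
split=> [|x0 j l ltj ltl]; first by rewrite (map_inj_uniq h_inj) in up.
have := adj_p (h x0) j l; rewrite size_map !(nth_map x0) // => <- //.
have cq y : y \in q -> c (h y) = i by rewrite mem_q => /eqP.
by apply: c_adj; rewrite !cq ?mem_nth.
Qed.

(** * Edge deletion and non-bridges *)

Definition edge (T : eqType) (a b x y : T) : bool :=
  (x == a) && (y == b) || (x == b) && (y == a).

Definition del_edge (T : eqType) (e : rel T) (a b x y : T) : bool :=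
  e x y && ~~ edge a b x y.

Lemma simple_graphP (T : finType) (e : rel T) :
  reflect (irreflexive e /\ symmetric e) (simple_graph e).
Proof.
apply: (iffP andP) => [[/forallP irr /'forall_forallP sym] | [irr sym]].
  by split=> [x | x y]; [apply/negbTE/irr | apply/eqP/sym].
by split; [apply/forallP=> x; rewrite irr | apply/'forall_forallP=> x y; apply/eqP].
Qed.

Lemma edgeC (T : eqType) (a b x y : T) : edge a b x y = edge a b y x.
Proof. by rewrite /edge orbC; congr (_ || _); rewrite andbC. Qed.

Lemma del_edge_sym (T : eqType) (e : rel T) (a b : T) :
  symmetric e -> symmetric (del_edge e a b).
Proof. by move=> sym x y; rewrite /del_edge sym edgeC. Qed.

(* Among all darts, take one minimising the component of its head once the edge
   is deleted: if that edge is a bridge, then so is the next dart, which has a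
   smaller component. *)
Lemma exists_non_bridge (T : finType) (e : rel T) (k : nat) :
  simple_graph e -> regular k e -> connected_graph e -> 1 < k ->
  exists a b, e a b /\ connect (del_edge e a b) a b.
Proof.
move=> /simple_graphP[irr sym] /forallP reg_e /andP[T0 _] k1.
have next b a : exists2 c, e b c & c != a.
  have /card_gt0P[c] : 0 < #|[set y | e b y]%SET :\ a|.
    move: (cardsD1 a [set y | e b y]%SET); rewrite (eqP (reg_e b)).
    by case: #|_ :\ a| => //; case: (_ \in _) => k_eq; rewrite k_eq in k1.
  by rewrite !inE => /andP[nca ebc]; exists c.
pose sz (u : T * T) := #|connect (del_edge e u.1 u.2) u.2|.
have [x0 _] := card_gt0P T0; have [y0 exy0 _] := next x0 x0.
have [[a b] /= eab min_ab] := @arg_minnP _ (x0, y0) (fun u => e u.1 u.2) sz exy0.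
have [c ebc nca] := next b a.
have csym u v := sym_connect_sym (del_edge_sym u v sym).
have [con_ab | nab] := boolP (connect (del_edge e a b) a b); first by exists a, b.
have [con_bc | nbc] := boolP (connect (del_edge e b c) b c); first by exists b, c.
have := min_ab (b, c) ebc; rewrite leqNgt; case/negP; apply: proper_card.
have bc' : connect (del_edge e a b) b c.
  apply: connect1; rewrite /del_edge ebc /edge eqxx /= (negbTE nca) orbF.
  by apply: contraTN eab => /andP[/eqP-> _]; rewrite irr.
apply/properP; split; last first.
  by exists b; [exact: connect0 | rewrite /in_mem /= csym].
apply/fintype.subsetP=> x; rewrite /in_mem /= => cx.
(* As [bc] is a bridge, the component of [c] without [bc] avoids [b]. Its edges therefore survive
   the deletion of [ab], and it lies in the component of [b] there. *)
pose Q := [pred z | connect (del_edge e b c) c z && connect (del_edge e a b) b z].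
suff: x \in Q by rewrite inE => /andP[].
have cQ : fingraph.closed (del_edge e b c) Q.
  apply: intro_closed => // y z /= yz; rewrite !inE => /andP[cy b_y].
  have cz : connect (del_edge e b c) c z by apply: connect_trans cy (connect1 _).
  rewrite cz; apply: connect_trans b_y (connect1 _).
  have nb t : connect (del_edge e b c) c t -> t != b.
    by apply: contraTneq => ->; rewrite csym.
  case/andP: yz => eyz _.
  by rewrite /del_edge eyz /edge (negbTE (nb _ cy)) (negbTE (nb _ cz)) andbF.
by rewrite -(closed_connect cQ cx) inE connect0 bc'.
Qed.

(** * Degrees as sums *)

Lemma sum_two_points (T : finType) (x y : T) (P Q : bool) : x != y ->
  \sum_z ((P && (z == x)) || (Q && (z == y)) : nat) = P + Q.
Proof.
move=> nxy; have nyx : y != x by rewrite eq_sym.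
rewrite (bigD1 x) //= (bigD1 y) //= big1 => [|z /andP[/negbTE zx /negbTE zy]].
  by rewrite !eqxx (negbTE nxy) (negbTE nyx) !andbF !andbT orbF addn0.
by rewrite zx zy !andbF.
Qed.

Lemma card_neighbours (T : finType) (e : rel T) (x : T) :
  #|[set y | e x y]%SET| = \sum_y (e x y : nat).
Proof.
rewrite -sum1_card big_mkcond; apply: eq_bigr => y _.
by rewrite inE; case: (e x y).
Qed.

(** The lost degree is added on the left to avoid truncated subtraction; in the gluing, the cross
    edges contribute exactly this term. *)
Lemma sum_del_edge (T : finType) (e : rel T) (u v x : T) :
  simple_graph e -> e u v ->
  \sum_y (del_edge e u v x y : nat) + ((x == u) + (x == v)) = \sum_y (e x y : nat).
Proof.
move=> /simple_graphP[irr sym] euv.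
have nvu : v != u by apply: contraTneq euv => ->; rewrite irr.
rewrite -(sum_two_points (x == u) (x == v) nvu) -big_split.
apply: eq_bigr => y _; rewrite /del_edge -[_ || _]/(edge u v x y).
have : edge u v x y -> e x y.
  by case/orP=> /andP[/eqP-> /eqP->] //; rewrite sym.
by case: (edge _ _ _ _) => [/(_ isT)->|_]; rewrite /= ?andbT ?addn0.
Qed.

(** * Gluing two graphs by an edge swap *)

Section Glue.

Variables (k n m : nat) (e1 : rel 'I_n) (e2 : rel 'I_m).
Variables (a b : 'I_n) (c d : 'I_m).
Hypotheses (simp1 : simple_graph e1) (simp2 : simple_graph e2).
Hypotheses (ab : e1 a b) (cd : e2 c d).

Definition glue_rel (u v : 'I_n + 'I_m) : bool :=
  match u, v with
  | inl x, inl y => del_edge e1 a b x y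
  | inr x, inr y => del_edge e2 c d x y
  | inl x, inr y | inr y, inl x => (x == a) && (y == c) || (x == b) && (y == d)
  end.

Definition glue : {set 'I_(n + m) * 'I_(n + m)} :=
  [set u | glue_rel (fintype.split u.1) (fintype.split u.2)]%SET.

Lemma glue_ll x y : adj glue (lshift m x) (lshift m y) = del_edge e1 a b x y.
Proof. by rewrite /adj /glue /= finset.in_set /= !(unsplitK (inl _)). Qed.

Lemma glue_rr x y : adj glue (rshift n x) (rshift n y) = del_edge e2 c d x y.
Proof. by rewrite /adj /glue /= finset.in_set /= !(unsplitK (inr _)). Qed.

Lemma glue_lr x y : adj glue (lshift m x) (rshift n y) =
  (x == a) && (y == c) || (x == b) && (y == d).
Proof. by rewrite /adj /glue /= finset.in_set /= (unsplitK (inl _)) (unsplitK (inr _)). Qed.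

Lemma glue_rl y x : adj glue (rshift n y) (lshift m x) =
  (x == a) && (y == c) || (x == b) && (y == d).
Proof. by rewrite /adj /glue /= finset.in_set /= (unsplitK (inl _)) (unsplitK (inr _)). Qed.

Let glueE := (glue_ll, glue_rr, glue_lr, glue_rl).

Lemma glue_simple : simple_graph (adj glue).
Proof.
have [[irr1 sym1] [irr2 sym2]] := (simple_graphP _ simp1, simple_graphP _ simp2).
apply/simple_graphP; split=> [x | x y].
  by case: (split_ordP x) => z ->; rewrite glueE /del_edge ?irr1 ?irr2.
case: (split_ordP x) => u ->; case: (split_ordP y) => v ->; rewrite !glueE //.
  exact: del_edge_sym.
exact: del_edge_sym.
Qed.

Lemma glue_regular : regular k e1 -> regular k e2 -> regular k (adj glue).
Proof.
have [[irr1 sym1] [irr2 sym2]] := (simple_graphP _ simp1, simple_graphP _ simp2).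
have nab : a != b by apply: contraTneq ab => ->; rewrite irr1.
have ncd : c != d by apply: contraTneq cd => ->; rewrite irr2.
move=> /forallP reg1 /forallP reg2; apply/forallP=> x.
rewrite card_neighbours big_split_ord /=; case: (split_ordP x) => z ->.
  rewrite -(eqP (reg1 z)) card_neighbours -(sum_del_edge z simp1 ab); apply/eqP.
  congr (_ + _); first by apply: eq_bigr => y _; rewrite glueE.
  by rewrite -(sum_two_points _ _ ncd); apply: eq_bigr => y _; rewrite glueE.
rewrite -(eqP (reg2 z)) card_neighbours -(sum_del_edge z simp2 cd) addnC; apply/eqP.
congr (_ + _); first by apply: eq_bigr => y _; rewrite glueE.
rewrite -(sum_two_points _ _ nab); apply: eq_bigr => y _. rewrite glueE.
by rewrite andbC [_ && (z == d)]andbC.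
Qed.

(** The left side stays connected because [ab] is not a bridge. The cross edges then reach both [c]
    and [d], so the right side is covered even if [cd] is a bridge. *)
Lemma glue_connected : connect (del_edge e1 a b) a b ->
  connected_graph e1 -> connected_graph e2 -> connected_graph (adj glue).
Proof.
have [[_ sym1] [_ sym2]] := (simple_graphP _ simp1, simple_graphP _ simp2).
have [_ symg] := simple_graphP _ glue_simple.
have csym := sym_connect_sym symg.
move=> con_ab /andP[_ /'forall_forallP con1] /andP[_ /'forall_forallP con2].
rewrite /connected_graph; apply/andP; split.
  by apply/card_gt0P; exists (lshift m a).
pose Q := connect (adj glue) (lshift m a).
have step x y : Q x -> adj glue x y -> Q y.
  by move=> Qx xy; apply: connect_trans Qx (connect1 xy).
have Qa : Q (lshift m a) by exact: connect0.
have Qb : Q (lshift m b).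
  have cQ : fingraph.closed (del_edge e1 a b) [pred x | Q (lshift m x)].
    apply: intro_closed => [|x y xy /step]; last by apply; rewrite glue_ll.
    by exact/sym_connect_sym/del_edge_sym.
  by have := closed_connect cQ con_ab; rewrite !inE Qa => <-.
have Ql x : Q (lshift m x).
  have cQ : fingraph.closed e1 [pred x | Q (lshift m x)].
    apply: intro_closed => [|y z yz Qy]; first exact: sym_connect_sym.
    (* If the step uses the deleted edge, its head is [a] or [b], both already reached. *)
    have [/orP[]/andP[_ /eqP->] // | nyz] := boolP (edge a b y z).
    by apply: (step _ _ Qy); rewrite glue_ll /del_edge yz.
  by have := closed_connect cQ (con1 a x); rewrite !inE Qa => <-.
have Qc : Q (rshift n c) by apply: step Qa _; rewrite glue_lr !eqxx.
have Qd : Q (rshift n d) by apply: step Qb _; rewrite glue_lr !eqxx orbT.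
have Qr x : Q (rshift n x).
  have cQ : fingraph.closed e2 [pred x | Q (rshift n x)].
    apply: intro_closed => [|y z yz Qy]; first exact: sym_connect_sym.
    have [/orP[]/andP[_ /eqP->] // | nyz] := boolP (edge c d y z).
    by apply: (step _ _ Qy); rewrite glue_rr /del_edge yz.
  by have := closed_connect cQ (con2 c x); rewrite !inE Qc => <-.
have Qall x : Q x by case: (split_ordP x) => z ->.
by apply/'forall_forallP=> x y; apply: (connect_trans _ (Qall y)); rewrite csym.
Qed.

Lemma glue_induced_path_number :
  induced_path_number e1 + induced_path_number e2 <=
  induced_path_number (adj glue) + 8.
Proof.
have [[irr1 _] [irr2 _]] := (simple_graphP _ simp1, simple_graphP _ simp2).
have [I [f0 [f0_path cardI]]] := induced_path_number_coloring glue_simple.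
have [f1 [f1_path ia f10]] := isolate_vertex (lshift m a) f0_path.
have [f2 [f2_path ib f21]] := isolate_vertex (lshift m b) f1_path.
have [f3 [f3_path ic f32]] := isolate_vertex (rshift n c) f2_path.
have [f [f_path id f43]] := isolate_vertex (rshift n d) f3_path.
(* Each isolation refines the previous colouring, so vertices isolated earlier stay alone in [f]. *)
have {}ic x : f x = f (rshift n c) -> x = rshift n c by move/f43/ic.
have {}ib x : f x = f (lshift m b) -> x = lshift m b by move/f43/f32/ib.
have {}ia x : f x = f (lshift m a) -> x = lshift m a by move/f43/f32/f21/ia.
pose side (x : 'I_(n + m)) := x < n.
(* Both ends of a cross edge are isolated, so no class contains such an edge. *)
have adj_side x y : adj glue x y -> f x = f y -> side x = side y.
  case: (split_ordP x) => u ->; case: (split_ordP y) => v -> xy.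
  - by rewrite /side /= !ltn_ord.
  - move: xy; rewrite glue_lr => /orP[]/andP[/eqP-> /eqP->].
      by move/esym/ia->.
    by move/esym/ib->.
  - move: xy; rewrite glue_rl => /orP[]/andP[/eqP-> /eqP->].
      by move/ia->.
    by move/ib->.
  - by rewrite /side /= !ltnNge !leq_addr.
(* Induction along the path of a class: consecutive vertices lie on the same side. *)
have f_side x y : f x = f y -> side x = side y.
  move=> fxy; have [p def_p [_ adj_p]] := f_path (f x).
  have fp z : z \in p -> f z = f x by rewrite def_p inE => /eqP.
  have side0 i : i < size p -> side (nth x p i) = side (nth x p 0).
    elim: i => // i IHi lti; rewrite -IHi ?(ltnW lti) //; apply/esym/adj_side.
      by rewrite adj_p ?eqxx // ltnW.
    by rewrite !fp // mem_nth // ltnW.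
  have [xp yp] : x \in p /\ y \in p by split; rewrite def_p inE ?fxy.
  by rewrite -(nth_index x xp) -(nth_index x yp) !side0 ?index_mem.
have sidel x : side (lshift m x) by exact: (ltn_ord x).
have sider x : ~~ side (rshift n x) by rewrite /side -leqNgt leq_addr.
have f_path1 : path_coloring e1 (f \o @lshift n m).
  apply: path_coloring_comp f_path _ _ => [|x y /f_side|x y fxy].
  - exact: lshift_inj.
  - case: (split_ordP y) => z ->; first by move=> _; apply: codom_f.
    by rewrite sidel => /esym; rewrite (negbTE (sider z)).
  (* Restoring the edge [ab] changes no class, since [a] and [b] have different labels. *)
  - rewrite glue_ll /del_edge andb_idr // => e1xy; apply: contraTN e1xy.
    case/orP=> /andP[/eqP xe /eqP ye]; move: fxy; rewrite xe ye.
      by move/ib/lshift_inj->; rewrite irr1.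
    by move/ia/lshift_inj->; rewrite irr1.
have f_path2 : path_coloring e2 (f \o @rshift n m).
  apply: path_coloring_comp f_path _ _ => [|x y /f_side|x y fxy].
  - exact: rshift_inj.
  - case: (split_ordP y) => z ->; last by move=> _; apply: codom_f.
    by rewrite sidel (negbTE (sider x)).
  - rewrite glue_rr /del_edge andb_idr // => e2xy; apply: contraTN e2xy.
    case/orP=> /andP[/eqP xe /eqP ye]; move: fxy; rewrite xe ye.
      by move/id/rshift_inj->; rewrite irr2.
    by move/ic/rshift_inj->; rewrite irr2.
pose A1 := [set f (lshift m x) | x : 'I_n]%SET.
pose A2 := [set f (rshift n x) | x : 'I_m]%SET.
have leA1 : induced_path_number e1 <= #|A1|.
  by apply: induced_path_number_le f_path1 _ => // x; apply: imset_f.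
have leA2 : induced_path_number e2 <= #|A2|.
  by apply: induced_path_number_le f_path2 _ => // x; apply: imset_f.
apply: leq_trans (leq_add leA1 leA2) _; rewrite -cardsUI.
rewrite (_ : A1 :&: A2 = finset.set0)%SET; last first.
  apply/setP=> i; rewrite !inE; apply/andP=> -[/imsetP[x _ ->] /imsetP[y _]].
  by move=> /f_side; rewrite sidel (negbTE (sider y)).
rewrite cards0 addn0; apply: leq_trans (max_card _) _.
(* Four isolations, each wrapping the label type in two options, account for the 8. *)
by rewrite !card_option cardI (addnC _ 8).
Qed.

End Glue.

(** * Bounds and superadditivity of the maximum *)

Lemma max_induced_path_number_attained (k n : nat) : admissible_order k n ->
  exists2 E : {set 'I_n * 'I_n}, connected_regular k E &
    max_induced_path_number k n = induced_path_number (adj E).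
Proof.
move=> /existsP[E0 cE0].
have [|E cE maxE] := @eq_bigmax_cond _ [pred E | connected_regular k E]
  (fun E : {set 'I_n * 'I_n} => induced_path_number (adj E)).
  by apply/card_gt0P; exists E0.
by exists E.
Qed.

Lemma max_induced_path_number_le (k n : nat) : max_induced_path_number k n <= n.
Proof.
apply/bigmax_leqP=> E /and3P[simpE _ _].
have [_ minE] := induced_path_numberP simpE.
apply: leq_trans (minE _ (trivial_factorP simpE)) _.
by apply: leq_trans (leq_imset_card _ _) _; rewrite card_ord.
Qed.

Lemma admissible_order_gt0 (k n : nat) : admissible_order k n -> 0 < n.
Proof. by case/existsP=> E /and3P[_ _ /andP[]]; rewrite card_ord. Qed.

Lemma max_induced_path_number_superadditive (k n m : nat) : 1 < k ->
  admissible_order k n -> admissible_order k m ->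
  admissible_order k (n + m) /\
  max_induced_path_number k n + max_induced_path_number k m <=
  max_induced_path_number k (n + m) + 8.
Proof.
move=> k1 /max_induced_path_number_attained[E1 /and3P[simp1 reg1 con1] ->].
move=> /max_induced_path_number_attained[E2 /and3P[simp2 reg2 con2] ->].
have [a [b [ab con_ab]]] := exists_non_bridge simp1 reg1 con1 k1.
(* For the second graph this only supplies an edge. *)
have [c [d [cd _]]] := exists_non_bridge simp2 reg2 con2 k1.
pose E := glue (adj E1) (adj E2) a b c d.
have cE : connected_regular k E.
  apply/and3P; split; first exact: glue_simple.
    exact: glue_regular.
  exact: glue_connected.
split; first by apply/existsP; exists E.
apply: leq_trans (glue_induced_path_number a b c d simp1 simp2) _.
by rewrite leq_add2r; exact: (leq_bigmax_cond _ cE).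
Qed.

(** * Fekete's lemma on an additive semigroup *)

Local Open Scope classical_set_scope.
Local Open Scope ring_scope.

(* Each residue class modulo [m] met by [S] has a least member [s]; iterating
   superadditivity along [s + q * m] bounds [g] below on that class, and there are
   finitely many classes. *)
Lemma superadditive_ge_linear (R : realType) (S : pred nat) (g : nat -> R) (m : nat) :
  S m -> (0 < m)%N ->
  (forall i j, S i -> S j -> S (i + j)%N /\ g i + g j <= g (i + j)%N) ->
  exists K, forall n, S n -> n%:R * (g m / m%:R) - K <= g n.
Proof.
move=> Sm m0 Sadd; have m0R : (m%:R : R) != 0 by rewrite pnatr_eq0 -lt0n.
have iterm s q : S s -> S (s + q * m)%N /\ g s + q%:R * g m <= g (s + q * m)%N.
  move=> Ss; elim: q => [|q [Sq IHq]]; first by rewrite addn0 mul0r addr0.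
  have [Sq' le_q] := Sadd _ _ Sq Sm.
  have -> : (s + q.+1 * m = s + q * m + m)%N by rewrite mulSn addnCA addnC.
  by split=> //; rewrite -natr1 mulrDl mul1r addrA (le_trans _ le_q) ?lerD2r.
have resid r : exists K, forall n, S n -> (n %% m = r)%N ->
    n%:R * (g m / m%:R) - K <= g n.
  have [exS | noS] := pselect (exists s, S s && (s %% m == r)%N); last first.
    by exists 0 => n Sn nr; case: noS; exists n; rewrite Sn nr eqxx.
  case: (ex_minnP exS) => s /andP[Ss /eqP sr] min_s.
  (* With [n = s + q * m], the bound is a rewriting of [g s + q * g m <= g n]. *)
  exists (s%:R * (g m / m%:R) - g s) => n Sn nr.
  have le_sn : (s <= n)%N by apply: min_s; rewrite Sn nr eqxx.
  have [q def_n] : exists q, n = (s + q * m)%N.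
    exists ((n - s) %/ m)%N; rewrite divnK ?subnKC //.
    by rewrite -eqn_mod_dvd // nr sr.
  have [_] := iterm s q Ss; rewrite -def_n; apply: le_trans.
  rewrite {1}def_n natrD natrM mulrDl -!mulrA (mulrCA m%:R) mulfV // mulr1; lra.
(* The constants of the residues below [M] are merged by taking maxima; [M = m] covers every [n]. *)
have bound M : exists K, forall n, S n -> (n %% m < M)%N ->
    n%:R * (g m / m%:R) - K <= g n.
  elim: M => [|M [K hK]]; first by exists 0.
  have [K' hK'] := resid M; exists (Num.max K K') => n Sn.
  rewrite ltnS leq_eqVlt => /orP[/eqP nM | nM].
    by apply: le_trans (hK' n Sn nM); rewrite lerB // le_max lexx orbT.
  by apply: le_trans (hK n Sn nM); rewrite lerB // le_max lexx.
by have [K hK] := bound m; exists K => n Sn; apply: hK; rewrite ?ltn_mod.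
Qed.

(** Subtracting [C] makes [f] superadditive, as the left side loses [2 * C] and the right side only
    [C] beyond the slack. The limit is the supremum of [(f m - C) / m] over [S]; bounded errors
    vanish after division by [n]. *)
Lemma fekete_within (R : realType) (S : pred nat) (f : nat -> R) (C B : R) :
  0 <= C -> (forall n, S n -> (0 < n)%N) ->
  (forall i j, S i -> S j -> S (i + j)%N /\ f i + f j <= f (i + j)%N + C) ->
  (forall n, S n -> f n <= B * n%:R) ->
  exists c : R, f n / n%:R @[n --> within [set n | S n] \oo] --> c.
Proof.
move=> C0 S0 Sadd fB; pose g n := f n - C.
pose A := [set g m / m%:R | m in [set n | S n]].
have ubA : ubound A B.
  move=> _ /= [m Sm <-]; rewrite ler_pdivrMr ?ltr0n ?S0 //.
  by apply: le_trans (fB m Sm); rewrite /g; lra.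
exists (sup A); apply/cvgrPdist_lt => e e0.
(* If [S] is empty, convergence within it is vacuous. *)
have [[m0 Sm0] | noS] := pselect (exists m, S m); last first.
  by exists 0 => // n _ /= Sn; case: noS; exists n.
have supA : has_sup A by split; [exists (g m0 / m0%:R), m0 | exists B].
have [|_ [m Sm <-] lt_m] := @sup_adherent _ A (e / 2) _ supA; first by lra.
have [|K hK] := @superadditive_ge_linear R S g m Sm (S0 m Sm).
  move=> i j Si Sj; have [Sij le_ij] := Sadd i j Si Sj.
  by split=> //; rewrite /g; lra.
(* Beyond [N], the errors [K] and [C] together stay below [n * (e / 2)]; the other half of [e] is
   spent on approximating the supremum. *)
pose N := Num.truncn ((`|K| + C) / (e / 2)).
exists N.+1 => // n /= ltNn Sn.
have n0 : 0 < (n%:R : R) by rewrite ltr0n S0.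
have big_n : `|K| + C < n%:R * (e / 2).
  rewrite -ltr_pdivrMr; last by lra.
  by apply: lt_le_trans (truncnS_gt _) _; rewrite ler_nat.
have up : g n <= sup A * n%:R.
  by rewrite -ler_pdivrMr //; apply: ub_le_sup; [case: supA | exists n].
have low : n%:R * (sup A - e / 2) - K <= g n.
  apply: le_trans (hK n Sn); rewrite lerB // ler_pM2l // ltW //.
have := ler_norm K => leK.
rewrite /g in up low.
rewrite ltr_distlC; apply/andP; split.
  by rewrite ltr_pdivlMr //; lra.
rewrite ltr_pdivrMr //.
lra.
Qed.

Theorem lemma22 (R : realType) (k : nat) (hk : (2 <= k)%N) :
  exists c : R,
    ((max_induced_path_number k n)%:R / n%:R : R)
      @[n --> within [set n : nat | admissible_order k n] \oo] --> c.
Proof.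
(* The defect 8 comes from gluing, and the slope 1 from the factor into single vertices. *)
apply: (@fekete_within R (admissible_order k) (fun n => (max_induced_path_number k n)%:R) 8 1) => //.
- exact: admissible_order_gt0.
- move=> i j Si Sj.
  have [Sij le_ij] := max_induced_path_number_superadditive hk Si Sj.
  by split=> //; rewrite -!natrD ler_nat.
- by move=> n _; rewrite mul1r ler_nat max_induced_path_number_le.
Qed.
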